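(* Let $n$ be a positive integer all of whose components are congruent to $1$ modulo $6$. Then there exists a $(G_1\times V_n,G_1\times\{0\},3,1)$ difference family which is $J$-resolvable for $J=\{0,(0,1,1,0)\}$ and which admits a group of strong multipliers whose order is the greatest divisor of $\psi(n)$ coprime with $6$.
   Context: A component of an integer is a maximal prime power dividing it. For $N$ with components $q_1,\dots,q_\omega$, $\mathbb F_N=\mathbb F_{q_1}\times\dots\times\mathbb F_{q_\omega}$, $V_N$ is its additive group ($V_1$ trivial), and $\psi(N)=\prod_i(q_i-1)$. $G_1$ is the group on $\mathbb Z_3\times\mathbb Z_2\times\mathbb Z_2$ with $(a,b,c)+(d,e,f)=(a,b,c)\Theta^d+(d,e,f)$, $\Theta$ the matrix with rows $(1,0,0),(0,0,1),(0,-1,-1)$ acting on row vectors. Groups are written additively, $x-y:=x+(-y)$. For $H\le G$, a $(G,H,3,1)$ difference family is a family $\mathcal F$ of $3$-subsets of $G$ whose multiset of differences $x-y$ (over ordered pairs of distinct elements in a common block) equals $G\setminus H$ (each element once); for $J\le H$ of order $2$ it is $J$-resolvable if the multiset union of its blocks is a complete system of representatives for the left cosets of $J$ not contained in $H$. A strong multiplier is an automorphism of $G$ fixing $H$ elementwise and mapping the set of blocks onto itself. *)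

(* Defs.v *)
From HB Require Import structures.
From mathcomp Require Import all_boot all_order all_algebra.
From mathcomp Require Import all_fingroup all_solvable all_field.

Set Implicit Arguments.
Unset Strict Implicit.
Unset Printing Implicit Defensive.

Import GRing.Theory.

Definition components (n : nat) : seq nat :=
  [seq (p ^ logn p n)%N | p <- primes n].

Definition psi (n : nat) : nat := \prod_(q <- components n) (q - 1).

(* The field with q elements; a junk value when q is not a prime power. *)
Definition GF (q : nat) : finFieldType :=
  match @idP (prime (pdiv q)), @idP (0 < logn (pdiv q) q) with
  | ReflectT pr_p, ReflectT k_gt0 => s2val (pPrimePowerField pr_p k_gt0)
  | _, _ => 'F_2
  end.

Lemma card_GF p k : prime p -> 0 < k -> #|GF (p ^ k)| = (p ^ k)%N.
Proof.
move=> pr_p k_gt0; rewrite /GF.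
have Ep : pdiv (p ^ k) = p by rewrite -(prednK k_gt0) pdiv_pfactor.
have Ek : logn (pdiv (p ^ k)) (p ^ k) = k by rewrite Ep pfactorK.
case: {-}_ / idP => [h1|]; last by rewrite Ep.
case: {-}_ / idP => [h2|]; last by rewrite Ek.
by case: pPrimePowerField => F /= _ ->; rewrite Ek Ep.
Qed.

(* The direct product of the additive groups of the fields GF q; the empty
   product when n = 1. *)
Definition V (n : nat) : finGroupType :=
  {dffun forall i : 'I_(size (components n)),
     (GF (nth 0%N (components n) i) : finGroupType)}.

(* An alias, so as not to inherit the componentwise group law. *)
Definition G1 : Type := ('Z_3 * 'Z_2 * 'Z_2)%type.

HB.instance Definition _ := Finite.on G1.

Section G1Law.
Local Open Scope ring_scope.

(* The row vector (a, b, c) times the integer matrix Theta below, reduced modulo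
   (3, 2, 2); see theta_iterE. *)
Definition theta (v : G1) : G1 :=
  let: (a, b, c) := v in (a, - c, b - c).

Definition G1_add (v w : G1) : G1 :=
  let: (d, e, f) := w in
  let: (a, b, c) := iter d theta v in (a + d, b + e, c + f).

Definition G1_zero : G1 := (0, 0, 0).

Definition G1_opp (v : G1) : G1 :=
  let: (a, b, c) := iter (3 - v.1.1) theta v in (- a, - b, - c).

Definition Theta : 'M[int]_3 :=
  \matrix_(i, j) nth 0 (nth [::] [:: [:: 1;  0;  0];
                                     [:: 0;  0;  1];
                                     [:: 0; -1; -1]] i) j.

Definition G1_red (u : 'rV[int]_3) : G1 :=
  ((u 0 0)%:~R, (u 0 1)%:~R, (u 0 2%:R)%:~R).

Lemma theta_iterE (u : 'rV[int]_3) (d : nat) :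
  iter d theta (G1_red u) = G1_red (u *m Theta ^+ d).
Proof.
have step (w : 'rV[int]_3) : theta (G1_red w) = G1_red (w *m Theta).
  rewrite /theta /G1_red !mxE !big_ord_recl !big_ord0 !mxE /=.
  rewrite !mulr0 !mulr1 !addr0 !add0r ?mulrN1 ?intrD ?rmorphN /=.
  have E1 : lift ord0 ord0 = 1 :> 'I_3 by apply/val_inj.
  have E2 : lift ord0 (lift ord0 ord0) = 2%:R :> 'I_3 by apply/val_inj.
  by rewrite E1 E2.
elim: d => [|d IHd]; first by rewrite expr0 mulmx1.
by rewrite iterS IHd step exprSr -mulmxA.
Qed.

Let G1_enum : seq G1 :=
  [seq (ab, c) | ab <- [seq (a, b) | a <- [:: 0; 1; -1], b <- [:: 0; 1]],
                 c <- [:: 0; 1]].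

Let G1_all (P : pred G1) : all P G1_enum -> forall v, P v.
Proof.
move=> /allP allP v; apply: allP.
by case: v => [[[[|[|[|//]]] ?] [[|[|//]] ?]] [[|[|//]] ?]].
Qed.

Fact G1_addA : associative G1_add.
Proof.
move=> u v w; apply/eqP; move: w; apply: G1_all; move: v; apply: G1_all.
by move: u; apply: G1_all; vm_compute.
Qed.

Fact G1_add0 : left_id G1_zero G1_add.
Proof. by move=> v; apply/eqP; move: v; apply: G1_all; vm_compute. Qed.

Fact G1_addN : left_inverse G1_zero G1_opp G1_add.
Proof. by move=> v; apply/eqP; move: v; apply: G1_all; vm_compute. Qed.

End G1Law.

HB.instance Definition _ :=
  Finite_isGroup.Build G1 G1_addA G1_add0 G1_addN.

Local Open Scope group_scope.

(* MathComp groups are multiplicative: the difference x - y is x * y^-1. *)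
Section DifferenceFamilies.

Variables (gT : finGroupType) (G H J : {group gT}) (F : seq {set gT}).

Definition differences : seq gT :=
  flatten [seq [seq x * y^-1 | x <- enum B, y <- enum (B :\ x)] | B <- F].

Definition difference_family : Prop :=
  [/\ H \subset G,
      {in F, forall B : {set gT}, B \subset G /\ #|B| = 3}
    & perm_eq differences (enum (G :\: H))].

(* The multiset union of the blocks meets every left coset of J not contained
   in H exactly once, and every other left coset of J not at all. *)
Definition resolvable : Prop :=
  [/\ J \subset H, #|J| = 2
    & {in lcosets J G, forall C : {set gT},
         count [in C] (flatten [seq enum B | B : {set gT} <- F])
           = ~~ (C \subset H)}].

Definition strong_multiplier (f : {perm gT}) : Prop :=
  [/\ f \in Aut G, {in H, forall x, f x = x}
    & [set f @: (B : {set gT}) | B in F] = [set B in F]].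

End DifferenceFamilies.

Section TheSubgroups.

Variable n : nat.

Definition G1V : finGroupType := (G1 * V n)%type.

Definition G1V0 : {group G1V} := [group of setX [set: G1] [1 V n]].

Definition J0110 : {set G1V} := [set 1; (((0, 1, 1)%R : G1), 1)].

Fact J0110_group_set : group_set J0110.
Proof.
apply/group_setP; split=> [|x y]; first by rewrite !inE eqxx.
rewrite !inE => /orP[]/eqP-> /orP[]/eqP->; rewrite ?mul1g ?mulg1 ?eqxx ?orbT //.
by apply/orP; left; apply/eqP; congr pair; [apply/eqP | apply: mulg1].
Qed.

Canonical J0110_group := Group J0110_group_set.

End TheSubgroups.

(* Main.v *)
(** Let [e] be a scalar whose components are primitive sixth roots of unity,
    acting on [V n], and let [A] be the Hall subgroup of order coprime to 6 in
    the product of the multiplicative groups of the fields.  Since [|A|] is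
    coprime to 6, a nonzero vector [r] with [a r = e^k r], [a] in [A], satisfies
    [e^k = 1]; hence the powers of [e] acting on the nonzero vectors have an
    [A]-stable transversal [T].  The family consists of the blocks
    [{(x, e^k t) : (x, k) in B}] for [t] in [T] and [B] in a fixed list of twelve
    base blocks in [G1 * {0, ..., 5}].  A difference [z^j - z^k] of sixth roots
    of unity with [j - k] not divisible by 3 is a power of [z], or [1 + z] times
    a power of [z].  In the base blocks every [g : G1] occurs six times as a
    difference, always with the same one of the two factors [1], [1 + z] and with
    each power of [z] once, and every left coset of [{0, (0,1,1)}] occurs once
    with each exponent.  So every element outside [H] is a difference, every coset
    outside [H] meets a block, and counting shows that this happens only once. *)

From mathcomp Require Import all_boot all_order all_algebra.
From mathcomp Require Import all_fingroup all_solvable all_field.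
From mathcomp Require Import ring.
Require Import Defs.

Set Implicit Arguments.
Unset Strict Implicit.
Unset Printing Implicit Defensive.

Import GRing.Theory.

(** * Primitive sixth roots of unity and their differences *)

Section SixthRoots.
Local Open Scope ring_scope.

(** The nonzero elements are |F| - 1 distinct roots of X^(|F| - 1) - 1, so one of them is primitive;
    a suitable power of it has order [k]. *)
Lemma finField_prim_root (F : finFieldType) (k : nat) :
  (k %| #|F|.-1)%N -> exists z : F, k.-primitive_root z.
Proof.
move=> k_dvd; have F_gt1 := finRing_gt1 F.
have F_gt0 : (0 < #|F|.-1)%N by rewrite -ltnS prednK // ltnW.
have : has #|F|.-1.-primitive_root (enum [set~ (0 : F)]).
  apply: has_prim_root => //.
  - apply/allP=> x; rewrite mem_enum !inE => x_neq0; rewrite unity_rootE.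
    by apply/eqP/(mulfI x_neq0); rewrite -exprS prednK ?expf_card ?mulr1 // ltnW.
  - exact: enum_uniq.
  - by rewrite -cardE cardsC1.
case/hasP=> z _ z_prim; exists (z ^+ (#|F|.-1 %/ k)).
exact: dvdn_prim_root.
Qed.

Variables (F : fieldType) (z : F).
Hypothesis z_prim : 6.-primitive_root z.

(** Factor z^6 - 1 = (z^3 - 1)(z + 1)(z^2 - z + 1): the first two factors are nonzero because the
    order of [z] is exactly 6. *)
Lemma prim6_sqr : z ^+ 2 = z - 1.
Proof.
have z6 : z ^+ 6 = 1 := prim_expr_order z_prim.
have z3 : z ^+ 3 != 1 by rewrite -(prim_order_dvd z_prim).
have z2 : z ^+ 2 != 1 by rewrite -(prim_order_dvd z_prim).
have: (z ^+ 3 - 1) * ((z + 1) * (z ^+ 2 - (z - 1))) = 0.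
  by transitivity (z ^+ 6 - 1); [ring | rewrite z6 subrr].
move/eqP; rewrite !mulf_eq0 subr_eq0 (negPf z3) addr_eq0 subr_eq0 /=.
by case/orP=> /eqP // zN; rewrite zN sqrrN expr1n eqxx in z2.
Qed.

Lemma prim6_addr1_neq0 : 1 + z != 0.
Proof.
rewrite addrC addr_eq0; apply/eqP => zN.
by have := prim_order_dvd z_prim 2; rewrite zN sqrrN expr1n eqxx.
Qed.

(* [(b, l)] encodes [z ^+ j - z ^+ k = (if b then 1 + z else 1) * z ^+ l]; the
   value [l = 6] is junk, for [j - k] divisible by 3. *)
Definition diff_code (j k : nat) : bool * nat :=
  match ((j + (6 - k)) %% 6)%N with
  | 1 => (false, (k + 2) %% 6)%N
  | 2 => (true, (k + 2) %% 6)%N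
  | 4 => (true, (k + 3) %% 6)%N
  | 5 => (false, (k + 4) %% 6)%N
  | _ => (false, 6)%N
  end.

(** Since z^2 = z - 1 and z^3 = -1, every power below 6 is linear in [z], and each of the 36 cases
    becomes a ring identity. The bound on [l] discards the junk code. *)
Lemma prim6_diff (j k l : nat) (b : bool) :
  (j < 6)%N -> (k < 6)%N -> (l < 6)%N -> diff_code j k = (b, l) ->
  z ^+ j - z ^+ k = (if b then 1 + z else 1) * z ^+ l.
Proof.
have z3 : z ^+ 3 = - 1.
  by rewrite exprS prim6_sqr mulrBr mulr1 -expr2 prim6_sqr; ring.
have z4 : z ^+ 4 = - z by rewrite exprS z3 mulrN1.
have z5 : z ^+ 5 = 1 - z by rewrite exprS z4 mulrN -expr2 prim6_sqr opprB.
do 6?[case: j => [|j] //]; move=> _;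
do 6?[case: k => [|k] //]; move=> _ l6; rewrite /diff_code /=; case=> // <- El;
move: l6; rewrite -El // => _;
rewrite ?expr0 ?expr1 ?prim6_sqr ?z3 ?z4 ?z5 ?mulrDl ?mulrDr ?mulrN;
rewrite -?expr2 ?prim6_sqr; ring.
Qed.

End SixthRoots.

(** * Scalars acting on a product of fields, and an [A]-stable transversal *)

Section FieldProduct.

Variables (I : finType) (K : I -> finFieldType).

Notation vectors := {dffun forall i : I, (K i : finGroupType)}.
Notation scalars := {dffun forall i : I, {unit K i}}.

Local Open Scope group_scope.

Definition scale (v : vectors) (u : scalars) : vectors :=
  [ffun i => (val (u i) * v i)%R].

Fact scale1 v : scale v 1 = v.
Proof. by apply/ffunP=> i; rewrite !ffunE mul1r. Qed.

Fact scaleM v u w : scale v (u * w) = scale (scale v u) w.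
Proof. by apply/ffunP=> i; rewrite !ffunE /= [(val (u i) * _)%R]mulrC mulrA. Qed.

Canonical scale_action := TotalAction scale1 scaleM.

Lemma scale_mulg v w u : scale (v * w) u = scale v u * scale w u.
Proof. by apply/ffunP=> i; rewrite !ffunE /= mulrDr. Qed.

Lemma scale_one u : scale 1 u = 1.
Proof. by apply/ffunP=> i; rewrite !ffunE /= mulr0. Qed.

Lemma scale_inj u : injective (scale^~ u).
Proof. exact: (act_inj scale_action). Qed.

Lemma scale_eq1 v u : (scale v u == 1) = (v == 1).
Proof. by rewrite -{1}(scale_one u) (inj_eq (@scale_inj u)). Qed.

Lemma scalars_mulgC (u w : scalars) : u * w = w * u.
Proof. by apply/ffunP=> i; rewrite !ffunE; apply: val_inj; rewrite /= mulrC. Qed.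

Lemma val_scalarsX (u : scalars) k i : val ((u ^+ k) i) = (val (u i) ^+ k)%R.
Proof.
elim: k => [|k IHk]; first by rewrite !ffunE.
by rewrite expgS !ffunE /= IHk exprS.
Qed.

Lemma card_scalars : #|scalars| = (\prod_i #|K i|.-1)%N.
Proof.
rewrite card_dep_ffun foldrE big_map big_enum /=; apply: eq_bigr => i _.
by rewrite -card_finField_unit cardsT.
Qed.

Lemma vectors_neq1 (v : vectors) : v != 1 -> exists i, v i != 0%R.
Proof.
move=> v1; apply/existsP; apply: contraNT v1 => /existsPn v0.
by apply/eqP/ffunP=> i; rewrite ffunE; apply/eqP; rewrite -[_ == _]negbK v0.
Qed.

Variable e : scalars.
Hypothesis e_prim : forall i, (6.-primitive_root (val (e i)))%R.

(** At a nonzero coordinate of [v], raising w e^j = e^k to the power [#[w]] kills [w], while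
    e^[#[w]] is still a primitive sixth root of unity because [#[w]] is coprime to 6. *)
Lemma scale_prim6_inj (v : vectors) (w : scalars) j k :
    v != 1 -> coprime #[w] 6 -> j < 6 -> k < 6 ->
  scale v (w * e ^+ j) = scale v (e ^+ k) -> j = k.
Proof.
move=> /vectors_neq1[i vi0] cw6 j6 k6 /ffunP/(_ i).
have w_order : (val (w i) ^+ #[w] = 1)%R.
  by rewrite -val_scalarsX expg_order ffunE.
rewrite !ffunE /= !val_scalarsX => /(mulIf vi0)/(congr1 (fun x => x ^+ #[w])%R).
rewrite exprMn w_order mul1r ![(_ ^+ _ ^+ #[w])%R]exprAC => /eqP.
have ew_prim : (6.-primitive_root (val (e i) ^+ #[w]))%R.
  by rewrite (prim_root_exp_coprime _ (e_prim i)).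
by rewrite (eq_prim_root_expr ew_prim) !modn_small // => /eqP.
Qed.

Variable A : {group scalars}.
Hypothesis A_coprime : coprime #|A| 6.

Let W := A <*> <[e]>.

(** From each [W]-orbit of nonzero vectors, keep the [A]-orbit of one chosen representative. Scaling
    by [A] preserves the [W]-orbit, hence the representative, which gives stability. *)
Definition prim6_transversal : {set vectors} :=
  [set v | (v != 1) &&
    (v \in orbit scale_action A (repr (orbit scale_action W v)))].

Local Notation T := prim6_transversal.

(** Scalars commute, so [W] is the product of [A] and the powers of [e], with exponents reduced
    modulo 6. *)
Let W_orbitP v w :
  reflect (exists2 a, a \in A & exists2 j, j < 6 & w = scale v (a * e ^+ j))
          (w \in orbit scale_action W v).
Proof.
have cAe : <[e]> \subset 'C(A).
  by apply/centsP=> x _ y _; apply: scalars_mulgC.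
apply: (iffP orbitP) => [[x /= Wx <-] | [a Aa [j _ ->]]]; last first.
  by exists (a * e ^+ j); rewrite //= /W cent_joinEr // mem_mulg ?mem_cycle.
move: Wx; rewrite /W cent_joinEr // => /mulsgP[a _ Aa /cycleP[j ->] ->].
exists a => //; exists (j %% 6); first exact: ltn_pmod.
congr (scale v (a * _)); apply/ffunP=> i; apply: val_inj.
by rewrite !val_scalarsX (prim_expr_mod (e_prim i)).
Qed.

Lemma prim6_transversal_stable t a : a \in A -> t \in T -> scale t a \in T.
Proof.
move=> Aa; rewrite !inE scale_eq1 => /andP[-> /= tT].
have -> : orbit scale_action W (scale t a) = orbit scale_action W t.
  apply/orbit_eqP/W_orbitP; exists a => //; exists 0 => //.
  by rewrite expg0 mulg1.
by apply: (orbit_trans _ tT); apply: mem_orbit.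
Qed.

Lemma prim6_transversal_cover v : v != 1 ->
  exists2 t, t \in T & exists2 j, j < 6 & v = scale t (e ^+ j).
Proof.
move=> v1; set r := repr (orbit scale_action W v).
have rO : r \in orbit scale_action W v := mem_repr v (orbit_refl _ _ _).
have: v \in orbit scale_action W r by rewrite orbit_sym.
case/W_orbitP=> a Aa [j j6 Ev]; rewrite scaleM in Ev.
exists (scale r a); last by exists j.
rewrite inE -(scale_eq1 _ (e ^+ j)) -Ev v1 /=.
suff -> : orbit scale_action W (scale r a) = orbit scale_action W v.
  by rewrite -/r (mem_orbit scale_action).
apply/orbit_eqP; apply: (orbit_trans _ rO); apply/W_orbitP.
by exists a => //; exists 0; rewrite // expg0 mulg1.
Qed.

(** The hypothesis puts [t] and [s] in one [W]-orbit, so t = a r and s = b r for the same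
    representative [r]; then [scale_prim6_inj] applies with the scalar [a * b^-1] of [A]. *)
Lemma prim6_transversal_inj t s j k : t \in T -> s \in T -> j < 6 -> k < 6 ->
  scale t (e ^+ j) = scale s (e ^+ k) -> t = s /\ j = k.
Proof.
move=> tT sT j6 k6 Ets; suff Ejk : j = k by move: Ets; rewrite Ejk => /scale_inj.
move: tT sT; rewrite !inE => /andP[t1 tO] /andP[s1 sO].
have Eo : orbit scale_action W t = orbit scale_action W s.
  have scale_orbit v l : l < 6 -> scale v (e ^+ l) \in orbit scale_action W v.
    by move=> l6; apply/W_orbitP; exists 1; rewrite //; exists l; rewrite ?mul1g.
  apply/orbit_eqP/(orbit_trans (y := scale t (e ^+ j))).
    by rewrite orbit_sym scale_orbit.
  by rewrite Ets scale_orbit.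
rewrite Eo in tO; set r := repr _ in tO sO.
case/orbitP: tO => a Aa /= Et; case/orbitP: sO => b Ab /= Es.
have r1 : r != 1 by rewrite -(scale_eq1 r a) Et.
apply: (@scale_prim6_inj r (a * b^-1) j k) => //.
  by apply: coprime_dvdl A_coprime; rewrite order_dvdG ?groupM ?groupV.
apply: (@scale_inj b); rewrite -!scaleM -mulgA ![e ^+ _ * b]scalars_mulgC.
by rewrite mulgA mulgKV !scaleM Et Es.
Qed.

(** The map (t, j) -> e^j t is a bijection from T x {0, ..., 5} onto the nonzero vectors. *)
Lemma card_prim6_transversal : (6 * #|T|)%N = #|vectors|.-1.
Proof.
rewrite -(cardsC1 (1 : vectors)).
rewrite -[6 in LHS](card_ord 6) mulnC -cardsT -cardsX.
have inj_f : {in setX T [set: 'I_6] &,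
    injective (fun p : vectors * 'I_6 => scale p.1 (e ^+ p.2))}.
  move=> [t j] [s k] /setXP[/= tT _] /setXP[/= sT _].
  by case/(prim6_transversal_inj tT sT) => // -> /val_inj->.
rewrite -(card_in_imset inj_f); congr #|pred_of_set _|.
apply/setP=> v; rewrite in_setC1; apply/imsetP/idP => [[[t j]] | v1].
  by case/setXP=> /=; rewrite inE => /andP[t1 _] _ ->; rewrite scale_eq1.
have [t tT [j j6 ->]] := prim6_transversal_cover v1.
by exists (t, Ordinal j6); rewrite ?inE ?andbT //=; rewrite inE in tT.
Qed.

End FieldProduct.

(** * The base blocks and the finite checks on them *)

Section BaseBlocks.

(* Found by an exact cover search; the pair [(x, k)] stands for the points
   [(x, e^k t)]. *)
Definition base_blocks : seq (seq (G1 * nat)) :=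
  [:: [:: ((2, 0, 1)%R, 1); ((0, 0, 0)%R, 2); ((1, 0, 1)%R, 3)];
      [:: ((0, 0, 0)%R, 0); ((2, 0, 0)%R, 2); ((1, 0, 0)%R, 4)];
      [:: ((2, 1, 0)%R, 0); ((1, 0, 0)%R, 1); ((0, 1, 0)%R, 2)];
      [:: ((2, 0, 1)%R, 3); ((0, 1, 1)%R, 4); ((2, 0, 0)%R, 5)];
      [:: ((0, 0, 1)%R, 0); ((1, 1, 0)%R, 1); ((2, 1, 0)%R, 5)];
      [:: ((2, 1, 1)%R, 0); ((2, 1, 0)%R, 4); ((1, 0, 1)%R, 5)];
      [:: ((1, 1, 1)%R, 3); ((0, 1, 0)%R, 4); ((1, 1, 1)%R, 5)];
      [:: ((2, 1, 0)%R, 2); ((0, 1, 1)%R, 3); ((2, 0, 0)%R, 4)];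
      [:: ((1, 1, 1)%R, 0); ((0, 0, 1)%R, 1); ((0, 1, 0)%R, 5)];
      [:: ((1, 0, 1)%R, 0); ((1, 0, 0)%R, 2); ((1, 0, 1)%R, 4)];
      [:: ((0, 1, 1)%R, 1); ((0, 1, 0)%R, 3); ((0, 1, 1)%R, 5)];
      [:: ((2, 1, 1)%R, 1); ((1, 0, 1)%R, 2); ((2, 0, 0)%R, 3)] ].

Let G1_enum : seq G1 :=
  [seq (ab, c) | ab <- [seq (a, b) | a <- [:: 0; 1; 2], b <- [:: 0; 1]],
                 c <- [:: 0; 1]]%R.

Let G1_all (P : pred G1) : all P G1_enum -> forall v, P v.
Proof.
move=> /allP allP v; apply: allP.
by case: v => [[[[|[|[|//]]] ?] [[|[|//]] ?]] [[|[|//]] ?]].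
Qed.

Lemma base_blocks_wf B : B \in base_blocks ->
  [/\ size B = 3, uniq [seq p.2 | p <- B] & {in B, forall p : G1 * nat, p.2 < 6}].
Proof.
have /allP wf : all (fun B => [&& size B == 3, uniq [seq p.2 | p <- B]
    & all (fun p : G1 * nat => p.2 < 6) B]) base_blocks by vm_compute.
by case/wf/and3P=> /eqP-> -> /allP.
Qed.

(** The factor [b] is fixed before [j]: a vector is first divided by this factor, and only then is
    the exponent [j] of the quotient known. *)
Lemma base_blocks_diff (g : G1) : exists b : bool, forall j, j < 6 ->
  exists2 B, B \in base_blocks & exists p q,
    [/\ p \in B, q \in B, (p.1 * q.1^-1)%g = g & diff_code p.2 q.2 = (b, j)].
Proof.
(* The group operations are replaced by the functions they unfold to, giving a boolean test
   evaluated at all twelve elements. *)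
have: has (fun b => all (fun j => has (fun B => has (fun p => has (fun q =>
      (G1_add p.1 (G1_opp q.1) == g) && (diff_code p.2 q.2 == (b, j))) B) B)
    base_blocks) (iota 0 6)) [:: true; false].
  by move: g; apply: G1_all; vm_compute.
case/hasP=> b _ /allP all_j; exists b => j j6.
have /all_j/hasP[B bB /hasP[p pB /hasP[q qB]]] : j \in iota 0 6.
  by rewrite mem_iota.
by case/andP=> /eqP Eg /eqP Ej; exists B => //; exists p, q; split.
Qed.

Lemma base_blocks_cosets (g : G1) j : j < 6 ->
  exists2 B, B \in base_blocks & exists2 p, p \in B &
    p.2 = j /\ (p.1 = g \/ p.1 = (g * ((0, 1, 1)%R : G1))%g).
Proof.
move=> j6; have: all (fun j => has (fun B => has (fun p => (p.2 == j) &&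
    ((p.1 == g) || (p.1 == G1_add g (0, 1, 1)%R))) B) base_blocks) (iota 0 6).
  by move: g; apply: G1_all; vm_compute.
move/allP/(_ j); rewrite mem_iota => /(_ j6)/hasP[B bB /hasP[p pB]].
by case/andP=> /eqP pj /orP[]/eqP pg; exists B => //; exists p => //; split; auto.
Qed.

End BaseBlocks.

Lemma size_differences (gT : finGroupType) (F : seq {set gT}) :
  {in F, forall B : {set gT}, #|B| = 3} -> size (differences F) = 6 * size F.
Proof.
move=> F3; rewrite /differences size_flatten /shape -map_comp sumnE big_map.
rewrite big_seq (eq_bigr (fun=> 6)); last first.
  move=> B BF; rewrite /= size_allpairs_dep sumnE big_map.
  rewrite big_seq (eq_bigr (fun=> 2)) => [|x].
    by rewrite -big_seq big_const_seq count_predT -cardE F3.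
  rewrite mem_enum => xB; rewrite -cardE; apply/succn_inj.
  by rewrite -(F3 _ BF) (cardsD1 x) xB.
by rewrite -big_seq big_const_seq count_predT iter_addn_0.
Qed.

(** * The lifted family: covering, then counting *)

Section Family.

Variable n : nat.

Let K (i : 'I_(size (components n))) : finFieldType := GF (nth 0 (components n) i).

Variable e : {dffun forall i, {unit K i}}.
Hypothesis e_prim : forall i, (6.-primitive_root (val (e i)))%R.

Variable T : {set V n}.
Hypothesis T_neq1 : {in T, forall t, t != 1%g}.
Hypothesis T_cover : forall v : V n, v != 1%g ->
  exists2 t, t \in T & exists2 j, j < 6 & v = scale t (e ^+ j)%g.
Hypothesis T_card : 6 * #|T| = #|V n|.-1.

Local Open Scope group_scope.

Definition lift_point (t : V n) (p : G1 * nat) : G1V n :=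
  (p.1, scale t (e ^+ p.2)).

Definition lift_block (B : seq (G1 * nat)) (t : V n) : {set G1V n} :=
  [set x in [seq lift_point t p | p <- B]].

Definition lift_family : seq {set G1V n} :=
  [seq lift_block B t | B <- base_blocks, t <- enum T].

Lemma lift_familyP X :
  reflect (exists2 B, B \in base_blocks & exists2 t, t \in T & X = lift_block B t)
          (X \in lift_family).
Proof.
apply: (iffP allpairsP) => [[[B t] /= [bB tT ->]] | [B bB [t tT ->]]].
  by exists B => //; exists t; rewrite // -mem_enum.
by exists (B, t); rewrite mem_enum.
Qed.

Lemma lift_point_in B t p : p \in B -> lift_point t p \in lift_block B t.
Proof. by move=> pB; rewrite inE map_f. Qed.

Lemma scale_expg_inj t j k : t != 1 -> j < 6 -> k < 6 ->
  scale t (e ^+ j) = scale t (e ^+ k) -> j = k.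
Proof.
move=> t1 j6 k6 Ejk; apply: (scale_prim6_inj e_prim t1 (w := 1)) => //.
  by rewrite order1 coprime1n.
by rewrite mul1g.
Qed.

Lemma card_lift_block B t : B \in base_blocks -> t \in T -> #|lift_block B t| = 3.
Proof.
move=> /base_blocks_wf[sB uB B6] tT.
suff: uniq [seq lift_point t p | p <- B].
  by rewrite /lift_block cardsE => /card_uniqP->; rewrite size_map.
rewrite map_inj_in_uniq ?(map_uniq uB) // => p q pB qB [Ep].
move/(scale_expg_inj (T_neq1 tT) (B6 _ pB) (B6 _ qB)) => Eq.
by rewrite [p]surjective_pairing [q]surjective_pairing Ep Eq.
Qed.

Lemma size_lift_family : size lift_family = (12 * #|T|)%N.
Proof. by rewrite size_allpairs -cardE. Qed.

Lemma card_lift_family X : X \in lift_family -> #|X| = 3.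
Proof. by case/lift_familyP=> B bB [t tT ->]; apply: card_lift_block. Qed.

Lemma lift_family_difference (g : G1) (v : V n) :
  v != 1 -> (g, v) \in differences lift_family.
Proof.
move=> v1; have [b diff_g] := base_blocks_diff g.
(* [d] is the factor 1 or 1 + e attached to [g]. It is invertible, so v / d = e^j t for some [t] in
   [T], and the base blocks realise [g] with code (b, j). *)
pose d i : K i := if b then (1 + val (e i))%R else 1%R.
have d0 i : d i != 0%R.
  by rewrite /d; case: (b); [apply: prim6_addr1_neq0 (e_prim i) | apply: oner_neq0].
pose w : V n := [ffun i => ((d i)^-1 * v i)%R].
have w1 : w != 1.
  apply: contraNneq v1 => Ew; apply/eqP/ffunP=> i.
  have := congr1 (fun f : {dffun forall i, K i} => f i) Ew; rewrite !ffunE => /(congr1 ( *%R (d i))).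
  by rewrite mulr0 (mulVKf (d0 i)).
have [t tT [j j6 Ew]] := T_cover w1.
have [B bB [p [q [pB qB Eg Ej]]]] := diff_g _ j6.
have [_ _ B6] := base_blocks_wf bB.
have Egv : lift_point t p * (lift_point t q)^-1 = (g, v).
  congr pair; first exact: Eg.
  apply/ffunP=> i; rewrite !ffunE /= !val_scalarsX.
  apply: etrans (esym (mulrBl _ _ _)) _.
  rewrite (prim6_diff (e_prim i) (B6 _ pB) (B6 _ qB) j6 Ej) -mulrA.
  have := congr1 (fun f : {dffun forall i, K i} => f i) Ew; rewrite !ffunE val_scalarsX => <-.
  by rewrite -/(d i) (mulVKf (d0 i)).
apply/flatten_mapP; exists (lift_block B t).
  by apply/lift_familyP; exists B => //; exists t.
apply/allpairsPdep; exists (lift_point t p), (lift_point t q).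
rewrite !mem_enum in_setD1 !lift_point_in //; split=> //; rewrite andbT.
(* The two points are distinct because their difference has second component [v], which is
   nonzero. *)
apply: contraNneq v1 => Epq; move: Egv; rewrite Epq mulgV.
by case=> _ <-.
Qed.

Lemma mem_G1V0 (x : G1V n) : (x \in G1V0 n) = (x.2 == 1).
Proof. by rewrite !inE. Qed.

Lemma card_G1 : #|{: G1}| = 12.
Proof. by rewrite !card_prod !card_ord. Qed.

Lemma lift_family_difference_family :
  difference_family [set: G1V n]%G (G1V0 n) lift_family.
Proof.
split=> [|X FX|]; first exact: subsetT.
  by split; [exact: subsetT | exact: card_lift_family].
have sub_diff : {subset enum ([set: G1V n] :\: G1V0 n) <= differences lift_family}.
  move=> [g v]; rewrite mem_enum in_setD mem_G1V0 andbC /= => /andP[_].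
  exact: lift_family_difference.
(* There are 6 * 12 |T| = 12 (|V| - 1) = |G| - |H| differences, so the covering list has no
   repetition and nothing extra. *)
have sz : size (differences lift_family) <= size (enum ([set: G1V n] :\: G1V0 n)).
  rewrite size_differences; last exact: card_lift_family.
  rewrite size_lift_family mulnCA T_card -cardE cardsD setTI cardsT cardsX cards1.
  by rewrite cardsT card_prod card_G1 muln1 -[X in _ <= _ - X]muln1 -mulnBr subn1.
have uD := leq_size_uniq (enum_uniq _) sub_diff sz.
apply: uniq_perm (enum_uniq _) _ => // x; apply/esym.
by case: (uniq_min_size (enum_uniq _) sub_diff sz).
Qed.

Lemma mem_J0110 (x : G1V n) :
  (x \in J0110_group n) = (x == 1) || (x == (((0, 1, 1)%R : G1), 1)).
Proof. by rewrite !inE. Qed.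

Lemma J0110_sub : J0110_group n \subset G1V0 n.
Proof. by apply/subsetP=> x; rewrite mem_J0110 mem_G1V0 => /orP[]/eqP->. Qed.

Lemma card_J0110 : #|J0110_group n| = 2.
Proof. by rewrite cards2; case: eqP => // /(congr1 fst). Qed.

Lemma lift_family_point (x : G1V n) : x \notin G1V0 n ->
  exists2 y, y \in flatten [seq enum X | X : {set G1V n} <- lift_family]
           & y \in x *: J0110_group n.
Proof.
case: x => g v; rewrite mem_G1V0 /= => v1.
have [t tT [j j6 Ev]] := T_cover v1.
have [B bB [p pB [pj pg]]] := base_blocks_cosets g j6.
exists (lift_point t p).
  apply/flatten_mapP; exists (lift_block B t).
    by apply/lift_familyP; exists B => //; exists t.
  by rewrite mem_enum lift_point_in.
rewrite /lift_point pj -Ev; apply/lcosetP; case: pg => ->.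
  by exists 1; rewrite ?group1 ?mulg1.
exists (((0, 1, 1)%R : G1), 1); first by rewrite mem_J0110 eqxx orbT.
by congr pair; rewrite /= mulg1.
Qed.

Lemma lift_family_resolvable :
  resolvable [set: G1V n]%G (G1V0 n) (J0110_group n) lift_family.
Proof.
split; [exact: J0110_sub | exact: card_J0110 | move=> C CG].
set J := J0110_group n; set H := G1V0 n; set L := flatten _.
pose L' := [seq x *: J | x <- L].
have mem_lcoset_eq x D : D \in lcosets J [set: G1V n] -> (x \in D) = (x *: J == D).
  by case/lcosetsP=> y _ ->; apply/lcoset_eqP/eqP.
(* Counting points of [C] amounts to counting occurrences of [C] among the cosets of the points. *)
have -> : count [in C] L = count_mem C L'.
  by rewrite count_map; apply: eq_count => x; rewrite /= mem_lcoset_eq.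
pose S := lcosets J [set: G1V n] :\: lcosets J H.
have H_sub D : D \in lcosets J [set: G1V n] -> (D \in lcosets J H) = (D \subset H).
  case/lcosetsP=> x _ ->; apply/lcosetsP/idP => [[y Hy ->] | sxH].
    by rewrite -(lcoset_id Hy) mulgS // J0110_sub.
  by exists x => //; apply: subsetP sxH x (lcoset_refl _ _).
have S_sub : {subset enum S <= L'}.
  move=> D; rewrite mem_enum in_setD => /andP[notH DG].
  have /lcosetsP[x _ ED] := DG; rewrite ED in notH *.
  have xH : x \notin H by apply: contra notH => xH; apply/lcosetsP; exists x.
  have [y yL /lcoset_eqP yx] := lift_family_point xH.
  by apply/mapP; exists y.
(* The blocks have 3 * 12 |T| points in all, and the cosets outside [H] number 12 |V| / 2 - 12 / 2 =
   6 (|V| - 1) = 36 |T|. *)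
have size_L : size L' <= size (enum S).
  rewrite size_map -cardE cardsD (setIidPr _) ?imsetS ?subsetT //.
  rewrite !card_lcosets -!divgS ?subsetT ?J0110_sub // card_J0110.
  rewrite cardsT cardsX cardsT cards1 muln1 card_prod card_G1.
  rewrite -[12]/(6 * 2)%N mulnAC !mulnK // -[X in _ <= _ - X]muln1 -mulnBr subn1.
  rewrite -T_card size_flatten /shape -map_comp sumnE big_map.
  rewrite big_seq (eq_bigr (fun=> 3)) => [|X XF]; last first.
    by rewrite /= -cardE card_lift_family.
  rewrite -big_seq big_const_seq count_predT iter_addn_0 size_lift_family.
  by rewrite !mulnA.
have uL := leq_size_uniq (enum_uniq _) S_sub size_L.
rewrite count_uniq_mem //.
have [_ <-] := uniq_min_size (enum_uniq _) S_sub size_L.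
by rewrite mem_enum in_setD CG H_sub // andbT.
Qed.

End Family.

(** * Scalars as strong multipliers *)

Section Multipliers.

Variable n : nat.

Let K (i : 'I_(size (components n))) : finFieldType := GF (nth 0 (components n) i).

Notation scalars := {dffun forall i, {unit K i}}.

Local Open Scope group_scope.

Definition scale_right (x : G1V n) (u : scalars) : G1V n := (x.1, scale x.2 u).

Fact scale_right1 x : scale_right x 1 = x.
Proof. by case: x => g v; rewrite /scale_right scale1. Qed.

Fact scale_rightM x u w : scale_right x (u * w) = scale_right (scale_right x u) w.
Proof. by rewrite /scale_right scaleM. Qed.

Canonical scale_right_action := TotalAction scale_right1 scale_rightM.

Lemma injm_scale_right : 'injm (actperm scale_right_action).
Proof.
apply/injmP=> u w _ _ Euw; apply/ffunP=> i; apply: val_inj.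
(* The action is faithful: the image of the all-ones vector determines the scalar. *)
pose one : V n := [ffun i => 1%R].
have /(congr1 snd) /= := congr1 (fun s : {perm G1V n} => s (1, one)) Euw.
rewrite !actpermE /= => /(congr1 (fun f : {dffun forall i, K i} => f i)).
by rewrite !ffunE !mulr1.
Qed.

Variables (e : scalars) (T : {set V n}) (A : {group scalars}).
Hypothesis T_stable : forall t a, a \in A -> t \in T -> scale t a \in T.

Lemma scale_right_lift_block B t u :
  actperm scale_right_action u @: lift_block e B t = lift_block e B (scale t u).
Proof.
have Eup p : scale_right (lift_point e t p) u = lift_point e (scale t u) p.
  by rewrite /scale_right /= -scaleM scalars_mulgC scaleM.
apply/setP=> x; rewrite inE; apply/imsetP/mapP => [[y] | [p pB ->]].
  by rewrite inE => /mapP[p pB ->] ->; exists p; rewrite ?actpermE //= Eup.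
by exists (lift_point e t p); rewrite ?lift_point_in ?actpermE //= Eup.
Qed.

Lemma lift_family_strong_multiplier f : f \in actperm scale_right_action @* A ->
  strong_multiplier [set: G1V n]%G (G1V0 n) (lift_family e T) f.
Proof.
case/morphimP=> u _ Au ->; split=> [|[g v]|].
- rewrite inE; apply/andP; split; first by apply/subsetP=> x; rewrite inE.
  apply/morphicP=> x y _ _; rewrite !actpermE /= /scale_right.
  by congr pair; apply: scale_mulg.
- by rewrite mem_G1V0 /= actpermE => /eqP->; rewrite /= /scale_right scale_one.
apply/setP=> X; rewrite inE; apply/imsetP/lift_familyP => [[Y] | [B bB [t tT ->]]].
  case/lift_familyP=> B bB [t tT ->] ->; exists B => //.
  by exists (scale t u); rewrite ?T_stable // scale_right_lift_block.
(* The preimage of a block is the block on u^-1 t, available because [T] is stable under the group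
   [A]. *)
exists (lift_block e B (scale t u^-1)).
  apply/lift_familyP; exists B => //; exists (scale t u^-1) => //.
  by rewrite T_stable ?groupV.
by rewrite scale_right_lift_block -scaleM mulVg scale1.
Qed.

End Multipliers.

(** A divisor of [m] coprime to [k] equals its own part prime to [k], hence divides that part of
    [m], which is itself such a divisor. *)
Lemma max_coprime_divisor (m k : nat) : 0 < m -> 0 < k ->
  \max_(d <- divisors m | coprime d k) d = m`_(\pi(k)^').
Proof.
move=> m_gt0 k_gt0; apply/eqP; rewrite eqn_leq; apply/andP; split.
  apply/bigmax_leqP_seq=> d; rewrite -dvdn_divisors // => dm cdk.
  apply: dvdn_leq (part_gt0 _ _) _.
  have d_gt0 := dvdn_gt0 m_gt0 dm.
  have <- : d`_(\pi(k)^') = d.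
    by apply: part_pnat_id; rewrite -coprime_pi' // coprime_sym.
  exact: partn_dvd.
apply: leq_bigmax_seq; first by rewrite -dvdn_divisors // dvdn_part.
by rewrite coprime_sym coprime_pi' ?part_gt0 // part_pnat.
Qed.

Theorem theorem7p6 (n : nat) (n_gt0 : 0 < n)
    (n_comp : {in components n, forall q : nat, q = 1 %[mod 6]}) :
  exists F : seq {set G1V n},
    [/\ difference_family [set: G1V n]%G (G1V0 n) F,
        resolvable [set: G1V n]%G (G1V0 n) (J0110_group n) F
      & exists2 A : {group {perm G1V n}},
          forall f : {perm G1V n},
            f \in A -> strong_multiplier [set: G1V n]%G (G1V0 n) F f
        & #|A| = \max_(d <- divisors (psi n) | coprime d 6) d].
Proof.
pose K (i : 'I_(size (components n))) := GF (nth 0 (components n) i).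
have cardK i : #|K i| = nth 0 (components n) i.
  rewrite /K; have /mapP[p p_n ->] := mem_nth 0 (ltn_ord i).
  by rewrite card_GF ?logn_gt0 //; move: p_n; rewrite mem_primes => /andP[].
have dvdK i : 6 %| #|K i|.-1.
  rewrite cardK -subn1; have K_mod := n_comp _ (mem_nth 0 (ltn_ord i)).
  rewrite -eqn_mod_dvd ?K_mod //.
  by rewrite -cardK; apply/card_gt0P; exists 0%R.
have /fin_all_exists[f f_prim] i :
    exists u : {unit K i}, (6.-primitive_root (val u))%R.
  have [z z_prim] := finField_prim_root (dvdK i).
  have z_unit : z \is a GRing.unit.
    by apply/unitrP; exists (z ^+ 5)%R; rewrite -exprS -exprSr prim_expr_order.
  by exists (FinRing.unit (K i) z_unit).
pose e : {dffun forall i, {unit K i}} := finfun f.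
have e_prim i : (6.-primitive_root (val (e i)))%R by rewrite ffunE.
(* The scalar group is abelian, so this core is a Hall subgroup: its order is the full part of
   [psi n] prime to 6. *)
pose A := 'O_(\pi(6)^')([set: {dffun forall i, {unit K i}}])%G.
have cardU : #|[set: {dffun forall i, {unit K i}}]| = psi n.
  rewrite cardsT card_scalars /psi (big_nth 0) big_mkord.
  by apply: eq_bigr => i _; rewrite cardK subn1.
have psi_gt0 : 0 < psi n by rewrite -cardU cardG_gt0.
have cardA : #|A| = (psi n)`_(\pi(6)^').
  rewrite -cardU; apply/card_Hall/nilpotent_pcore_Hall/abelian_nil.
  by apply/centsP=> u _ w _; apply: scalars_mulgC.
have A_coprime : coprime #|A| 6.
  by rewrite cardA coprime_sym coprime_pi' ?part_gt0 // part_pnat.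
pose T : {set V n} := prim6_transversal e A.
have T_neq1 : {in T, forall t, t != 1%g} by move=> t; rewrite inE => /andP[].
have T_cover := prim6_transversal_cover e_prim A.
have T_card : 6 * #|T| = #|V n|.-1 := card_prim6_transversal e_prim A_coprime.
exists (lift_family e T); split.
- exact: lift_family_difference_family.
- exact: lift_family_resolvable.
exists (actperm (scale_right_action n) @* A)%G => [s|].
  apply: lift_family_strong_multiplier => t a.
  exact: prim6_transversal_stable.
by rewrite card_injm ?injm_scale_right ?subsetT // max_coprime_divisor.
Qed.
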